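(* Let $\hat p\in\partial J(f)$ with $\|\hat p\|_{\mathcal H}=s_*$, where $s_*:=\inf\{\|q\|_{\mathcal H}:q\in\mathcal H,\ q\in\partial J(f)\}$, and let $K:=\partial J(0)$. Then $\hat\tau$ given by $$\hat\tau:=2\inf_{q\in K,\ \|q\|_{\mathcal H}\le\|\hat p\|_{\mathcal H}}\frac{J(f)-\langle q,f\rangle}{\|\hat p\|_{\mathcal H}^2-\|q\|_{\mathcal H}^2}$$ is positive if and only if $v_\tau:=f-\tau\hat p$ is the minimizer of $F_\tau(\cdot;f)$ for $\tau\in[0,\hat\tau]$.
   Context: Setting: $\mathcal X\hookrightarrow\mathcal H\hookrightarrow\mathcal X^*$ is a Gelfand triple, where $\mathcal X$ is the (real) Banach space dual of a separable Banach space, $\mathcal H$ is a real Hilbert space, and the continuous embedding $A:\mathcal X\to\mathcal H$ is omitted in the notation; the constraint on $\|q\|_{\mathcal H}$ in the infimum refers to elements $q$ of $K$ lying in $\mathcal H$. $J:\mathcal X\to[0,\infty]$ is convex, proper, weak$^*$ lower semi-continuous and absolutely one-homogeneous ($J(cu)=|c|J(u)$); $\mathcal N(J)=\{u:J(u)=0\}$; $\partial J(u)=\{p\in\mathcal X^*: J(u)+\langle p,v-u\rangle\le J(v)\ \forall v\in\mathcal X\}$, so $\partial J(0)=\{p\in\mathcal X^*:\langle p,v\rangle\le J(v)\ \forall v\in\mathcal X\}$. The datum is $f\in\mathcal X$ with $0<J(f)<\infty$. $F_\tau(v;f)=\frac12\|v-f\|_{\mathcal H}^2+\tau J(v)$,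 $v\in\mathcal X$, $\tau\ge0$. Standing assumptions: (1) the norms $\|\cdot\|_{\mathcal H}$ and $\|\cdot\|_{\mathcal X}$ are equivalent on $\mathcal N(J)$. (2) There is $C>0$ with $\|u-\mathcal P(u)\|_{\mathcal X}\le CJ(u)$ for all $u\in\mathcal X$, where $\mathcal P(u)$ is the minimizer of $\|w-u\|_{\mathcal H}$ over $w\in\mathcal N(J)$. (3) weak$^*$ convergence in $\mathcal X$ implies weak convergence in $\mathcal H$.
   Formalization: Since the minimizer claim on [0, τ̂] holds trivially when τ̂ = 0, the equivalence is stated with ''minimizer on [0,T] for some T > 0''; for τ̂ > 0 optimality on all of [0, τ̂] is also stated. In the infimum, quotients with zero denominator (such as q = p̂) count as +∞. *)

(* Defs.v *)
From HB Require Import structures.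
From mathcomp Require Import all_boot all_order all_algebra.
From mathcomp Require Import sesquilinear.
From mathcomp Require Import all_classical all_reals all_analysis.

Set Implicit Arguments.
Unset Strict Implicit.
Unset Printing Implicit Defensive.

Import Order.TTheory GRing.Theory Num.Theory.
Import numFieldNormedType.Exports.

Local Open Scope classical_set_scope.
Local Open Scope ring_scope.

Section SpacesAndDuality.
Context {R : realType}.

Definition separable (T : topologicalType) : Prop :=
  exists2 D : set T, countable D & dense D.

(* [x |-> (y |-> pair x y)] is an isometric isomorphism of [X] onto the dual of
   [Y] with the operator norm. *)
Definition dual_pairing (X Y : completeNormedModType R)
    (pair : {bilinear X -> Y -> R^o}) : Prop :=
  (forall x : X,
     (`|x|)%:E = ereal_sup [set (`|pair x y|)%:E | y in [set y : Y | `|y| <= 1]])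
  /\ (forall phi : {linear Y -> R^o}, continuous phi ->
        exists x : X, forall y : Y, pair x y = phi y).

(* [X] with the topology of pointwise convergence on the predual [Y]. *)
Definition weak_star (X Y : completeNormedModType R)
    (pair : {bilinear X -> Y -> R^o}) : Type :=
  initial_topology ((fun x : X => (fun y : Y => pair x y))
                    : X -> {ptws Y -> R^o}).

HB.instance Definition _ (X Y : completeNormedModType R)
    (pair : {bilinear X -> Y -> R^o}) :=
  Topological.copy (weak_star pair)
    (initial_topology ((fun x : X => (fun y : Y => pair x y))
                       : X -> {ptws Y -> R^o})).

Definition weak_cvg (V : normedModType R) (u : nat -> V) (x : V) : Prop :=
  forall phi : {linear V -> R^o}, continuous phi ->
    phi (u n) @[n --> \oo] --> phi x.

Definition is_hilbert (H : completeNormedModType R) (ip : {dot H for idfun}) :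
    Prop :=
  forall h : H, `|h| ^+ 2 = ip h h.

(* Density of the range makes [H_to_dual] below injective. *)
Definition gelfand_triple (X H : completeNormedModType R)
    (A : {linear X -> H}) : Prop :=
  [/\ continuous A, injective A & dense (range A)].

Definition H_to_dual (X H : completeNormedModType R) (ip : {dot H for idfun})
    (A : {linear X -> H}) (q : H) : X -> R^o :=
  fun v => ip q (A v).

Lemma H_to_dual_is_linear (X H : completeNormedModType R)
    (ip : {dot H for idfun}) (A : {linear X -> H}) (q : H) :
  linear (H_to_dual ip A q).
Proof. by move=> a u v; rewrite /H_to_dual linearP linearPr. Qed.

HB.instance Definition _ (X H : completeNormedModType R)
    (ip : {dot H for idfun}) (A : {linear X -> H}) (q : H) :=
  GRing.isLinear.Build R X R^o *:%R (H_to_dual ip A q)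
    (H_to_dual_is_linear ip A q).

End SpacesAndDuality.

Section Functionals.
Context {R : realType} {X : completeNormedModType R}.
Local Open Scope ereal_scope.

Definition nonneg_fun (J : X -> \bar R) : Prop := forall u, 0 <= J u.

Definition proper_fun (J : X -> \bar R) : Prop := exists u, J u < +oo.

Definition convex_fun (J : X -> \bar R) : Prop :=
  forall (u v : X) (t : R), (0 <= t <= 1)%R ->
    J (t *: u + (1 - t) *: v)%R <= t%:E * J u + (1 - t)%:E * J v.

Definition abs_one_homogeneous (J : X -> \bar R) : Prop :=
  forall (c : R) (u : X), J (c *: u)%R = (`|c|)%:E * J u.

Definition null_set (J : X -> \bar R) : set X := [set u | J u = 0].

(* The dual of [X] is the set of continuous elements of [{linear X -> R^o}]. *)
Definition subdiff (J : X -> \bar R) (u : X) : set {linear X -> R^o} :=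
  [set p : {linear X -> R^o} |
    continuous p /\ forall v : X, J u + (p (v - u)%R : R)%:E <= J v].

Definition is_minimizer (F : X -> \bar R) (v : X) : Prop :=
  forall w, F v <= F w.

Definition is_the_minimizer (F : X -> \bar R) (v : X) : Prop :=
  is_minimizer F v /\ forall w, is_minimizer F w -> w = v.

End Functionals.

Section Variational.
Context {R : realType} {X H : completeNormedModType R}.
Variables (ip : {dot H for idfun}) (A : {linear X -> H}) (J : X -> \bar R).
Local Open Scope ereal_scope.

Definition norms_equivalent_on_null_set : Prop :=
  exists c C : R, [/\ (0 < c)%R, (0 < C)%R &
    forall u, null_set J u -> (c * `|u| <= `|A u| <= C * `|u|)%R].

(* Existence and uniqueness of this [w] follow from
   [norms_equivalent_on_null_set] and the properties of [J]. *)
Definition is_null_projection (u w : X) : Prop :=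
  null_set J w /\
  forall w', null_set J w' -> (`|A w - A u| <= `|A w' - A u|)%R.

Definition poincare_inequality : Prop :=
  exists2 C : R, (0 < C)%R &
    forall u w, is_null_projection u w -> (`|u - w|)%:E <= C%:E * J u.

Definition F_functional (tau : R) (f v : X) : \bar R :=
  (2^-1 * `|A v - A f| ^+ 2)%:E + tau%:E * J v.

Definition s_star (f : X) : \bar R :=
  ereal_inf [set (`|q|)%:E | q in [set q : H | subdiff J f (H_to_dual ip A q)]].

(* Quotients with denominator 0 count as +oo.  In [tau_hat], for [p] of minimal
   norm in the subdifferential at [f], this happens when the numerator is
   positive, or when [q = p] and the expression is 0/0: neither contributes to
   the infimum. *)
Definition quotient_or_pinfty (x : \bar R) (d : R) : \bar R :=
  if d == 0%R then +oo else x * (d^-1)%:E.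

Definition tau_hat (f : X) (p : H) : \bar R :=
  2%:E * ereal_inf
    [set quotient_or_pinfty (J f - (H_to_dual ip A q f : R)%:E)
                            (`|p| ^+ 2 - `|q| ^+ 2)
    | q in [set q : H | subdiff J 0%R (H_to_dual ip A q) /\
                        (`|q| <= `|p|)%R]].

(* [f - tau p] is a priori only an element of [H]; being the minimizer over [X]
   includes that it lies in (the image of) [X]. *)
Definition affine_minimizer (f : X) (p : H) (tau : R) : Prop :=
  exists v : X, A v = (A f - tau *: p)%R /\
                is_the_minimizer (F_functional tau f) v.

End Variational.

(* Main.v *)
Require Import Defs.
From HB Require Import structures.
From mathcomp Require Import all_boot all_order all_algebra.
From mathcomp Require Import sesquilinear.
From mathcomp Require Import all_classical all_reals all_analysis.
From mathcomp Require Import ring lra.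

Set Implicit Arguments.
Unset Strict Implicit.
Unset Printing Implicit Defensive.

Import Order.TTheory GRing.Theory Num.Theory.
Import numFieldNormedType.Exports.
Local Open Scope classical_set_scope.
Local Open Scope ring_scope.

(** Write [K] for the set of [q] in [H] with [ip q (A w) <= J w] for all [w],
    that is, [q] in the subdifferential of [J] at 0.  By one-homogeneity, [q] is
    a subgradient at [u] exactly when [q] is in [K] and [J u = ip q (A u)].
    The embedding [A] is left out of the formulas below.

    The first-order condition for [tau > 0] says that a minimizer [v] of the
    functional [F_tau] satisfies [A v = A f - tau q] for a subgradient [q] at
    [v], so everything turns on whether this [q] equals [p].

    If [f - tau p] is the minimizer then [q = p], and testing any [q'] in [K]
    against [v = f - tau p] gives
    [J f - ip q' f >= tau (|p|^2 - ip q' p) >= tau / 2 (|p|^2 - |q'|^2)],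
    which says [tau <= tau_hat] ([affine_minimizer_le_tau_hat]).

    Conversely let [0 < tau <= tau_hat] and let [v], [q] be a minimizer and its
    subgradient.  Testing [p] against [v] gives
    [J f - ip q f <= tau (ip p q - |q|^2)].  The left side is nonnegative, so
    [|q| <= |p|] and [q] competes in the infimum that defines [tau_hat]; hence
    the left side is at least [tau / 2 (|p|^2 - |q|^2)].  The two bounds combine
    to [|p - q|^2 <= 0], so [q = p] ([minimizer_residual]).

    This needs a minimizer in [X] to start from.  It comes from the direct
    method: norm-bounded sequences have weak* convergent subsequences, since the
    predual is separable ([bounded_weak_star_subsequence]), and a functional
    made of a squared distance in [H] and a weak* lower semicontinuous term is
    lower semicontinuous along them ([direct_method]).  Sublevel sets of [F_tau]
    are bounded in [X] because [v] splits into its projection onto the null set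
    of [J], controlled in [X] by its norm in [H], and a remainder controlled by
    [J v] through the Poincare inequality.  The existence of that projection is
    a second application of [direct_method]. *)

(** * Weak* sequential compactness *)

Lemma cvg_initial (S : choiceType) (T : topologicalType) (h : S -> T)
    (F : set_system S) (x : S) : Filter F ->
  h @ F --> h x -> F --> (x : initial_topology h).
Proof.
move=> FF hF A /= [_ [[B oB <-] Bx sBA]].
have nB : nbhs (h x) B by apply: open_nbhs_nbhs; split.
exact: (filterS sBA (hF _ nB)).
Qed.

Lemma weak_star_cvg {R : realType} {X Y : completeNormedModType R}
    (pair : {bilinear X -> Y -> R^o}) (u : nat -> X) (v : X) :
  (forall y, pair (u n) y @[n --> \oo] --> pair v y) ->
  (u : nat -> weak_star pair) @ \oo --> (v : weak_star pair).
Proof.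
move=> uv; apply: cvg_initial.
rewrite cvg_sup => y; apply: cvg_initial; exact: uv.
Qed.

Lemma pairing_bound {R : realType} {X Y : completeNormedModType R}
    (pair : {bilinear X -> Y -> R^o}) (x : X) (y : Y) :
  dual_pairing pair -> `|pair x y| <= `|x| * `|y|.
Proof.
move=> [pn _]; have [->|y0] := eqVneq y 0.
  by rewrite linear0r !normr0 mulr0.
have ny : 0 < `|y| by rewrite normr_gt0.
rewrite -ler_pdivrMr// -lee_fin pn; apply: ereal_sup_ubound.
exists (`|y|^-1 *: y) => /=.
  by rewrite normrZ ger0_norm ?invr_ge0// mulVf// gt_eqF.
by rewrite linearZr normrZ ger0_norm ?invr_ge0// mulrC.
Qed.

Lemma linear_bound_continuous {R : realType} {V W : normedModType R}
    (g : {linear V -> W}) (M : R) :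
  (forall y, `|g y| <= M * `|y|) -> continuous g.
Proof.
move=> gM; apply: bounded_linear_continuous.
apply/linear_boundedP; near=> r => x.
by rewrite (le_trans (gM x))// ler_wpM2r//; near: r; exact: nbhs_pinfty_ge.
Unshelve. all: by end_near. Qed.

(** An ultrafilter converges to each of its cluster points, and compactness of
    [[-M, M]] provides one. *)
Lemma ultra_cvg_bounded {R : realType} (T : Type) (G : set_system T)
    (a : T -> R^o) (M : R) :
  UltraFilter G -> (forall n, `|a n| <= M) -> exists l : R^o, a @ G --> l.
Proof.
move=> UG aM.
have [|l [_ al]] := @segment_compact R (- M) M (a @ G).
  apply: (@filterS _ G _ setT) => [n _|]; last exact: filterT.
  by rewrite /= in_itv /= -ler_norml.
exists l => V nV /=; have [//|GV] := in_ultra_setVsetC (a @^-1` V) UG.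
by have [x [/= nVx Vx]] := al (~` V) V GV nV.
Qed.

Section BanachAlaoglu.
Context {R : realType} {X Y : completeNormedModType R}.
Context {pair : {bilinear X -> Y -> R^o}}.
Context (hpair : dual_pairing pair).

(** Banach-Alaoglu along an ultrafilter: the pointwise limits exist, depend
    linearly on [y] and are bounded by [M * `|y|], so they form an element of
    the dual of [Y], which is [X]. *)
Lemma ultra_weak_star_limit (T : Type) (G : set_system T) (u : T -> X) (M : R) :
  UltraFilter G -> (forall n, `|u n| <= M) ->
  exists v : X, forall y, pair (u n) y @[n --> G] --> pair v y.
Proof.
move=> UG uM.
have uyM n y : `|pair (u n) y| <= M * `|y|.
  by rewrite (le_trans (pairing_bound _ _ hpair))// ler_wpM2r.
have /choice[g gP] y : exists l : R^o, pair (u n) y @[n --> G] --> l.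
  exact: (@ultra_cvg_bounded _ _ _ _ (M * `|y|)).
have glin : linear (g : Y -> R^o).
  move=> c y z; apply/esym.
  apply: (@cvg_unique R^o _ (pair (u n) (c *: y + z) @[n --> G])).
    by apply: norm_hausdorff.
    rewrite (_ : (fun n => _) = (fun n => c *: pair (u n) y + pair (u n) z)).
      by apply: cvgD (gP z); apply: cvgZr (gP y).
    by apply/funext => n; rewrite linearPr.
  exact: gP.
pose gL : {linear Y -> R^o} := HB.pack g (GRing.isLinear.Build _ _ _ _ g glin).
have gc : continuous gL.
  apply: (@linear_bound_continuous _ _ _ _ M) => y.
  have ny : `|pair (u n) y| @[n --> G] --> `|g y| by exact: cvg_norm (gP y).
  apply: (cvgr_to_le ny); apply: (@filterS _ G _ setT); last exact: filterT.
  by move=> n _; exact: uyM.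
have [v vE] := hpair.2 gL gc.
by exists v => y; rewrite vE; exact: gP.
Qed.

(** Every member of an ultrafilter refining [\oo] is infinite, so [s k] can be
    picked beyond [k] in the member on which the first [k + 1] points of a dense
    sequence of [Y] are approximated up to [1 / (k + 1)].  Boundedness carries
    the convergence from the dense sequence to all of [Y].  The map [s] need not
    be increasing: [k <= s k] is what taking limits requires. *)
Lemma bounded_weak_star_subsequence (u : nat -> X) (M : R) :
  separable Y -> (forall n, `|u n| <= M) ->
  exists (s : nat -> nat) (v : X), (forall k, (k <= s k)%N) /\
    (u \o s : nat -> weak_star pair) @ \oo --> (v : weak_star pair).
Proof.
move=> [D cD dD] uM.
have [G [UG sG]] := @ultraFilterLemma _ (nbhs \oo) _.
have [v vP] := ultra_weak_star_limit UG uM.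
(* [get] has a default value outside the range of [h], so [d] may leave [D];
   only density of its range matters. *)
have [d dE] : exists d : nat -> Y, D `<=` range d.
  have [h hinj] := elimT (countable_injP _) cD.
  exists (fun n => get [set y | D y /\ h y = n]) => y Dy; exists (h y) => //.
  have [Dz hz] : [set z | D z /\ h z = h y] (get [set z | D z /\ h z = h y]).
    by apply: getPex; exists y.
  by apply: (hinj _ _ _ _ hz); rewrite inE.
have /choice[s sP] (k : nat) : exists n : nat, (k <= n)%N /\
    forall j, (j <= k)%N -> `|pair v (d j) - pair (u n) (d j)| < k.+1%:R^-1.
  have : G (fun n => (k <= n)%N /\
    forall j : 'I_k.+1, `|pair v (d j) - pair (u n) (d j)| < k.+1%:R^-1).
    apply: filterI; first by apply: sG; exact: nbhs_infty_ge.
    apply: filter_forall => j; have /cvgrPdist_lt := vP (d j); apply.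
    by rewrite invr_gt0.
  move=> /filter_ex[n [kn H]]; exists n; split => // j jk.
  by have := H (Ordinal (jk : (j < k.+1)%N)).
exists s, v; split; first by move=> k; have [] := sP k.
apply: weak_star_cvg => y; apply/cvgrPdist_lt => e e0.
have e2 : 0 < e / 2 by rewrite divr_gt0.
have M0 : 0 <= M := le_trans (normr_ge0 _) (uM 0%N).
pose K := `|v| + M + 1.
have K0 : 0 < K by rewrite ltr_wpDl// addr_ge0.
have eK : 0 < e / 2 / K by rewrite !divr_gt0.
(* [K] bounds the norm of [v - u (s k)], so moving [y] to [d j] costs at most
   [e / 2]. *)
have [j dj] : exists j, `|y - d j| < e / 2 / K.
  have [||z [yz Dz]] := dD (ball y (e / 2 / K)).
  - by exists y; exact: ballxx.
  - exact: ball_open.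
  - have [j _ jz] := dE _ Dz; exists j; rewrite jz.
    by move: yz; rewrite -ball_normE.
near=> k.
have -> : pair v y - pair (u (s k)) y =
    (pair v (y - d j) - pair (u (s k)) (y - d j)) +
    (pair v (d j) - pair (u (s k)) (d j)).
  by rewrite !linearBr; ring.
have -> : e = e / 2 + e / 2 by field.
rewrite (le_lt_trans (ler_normD _ _))// ler_ltD//; last first.
  apply: (lt_trans ((sP k).2 j _)); near: k.
    by exact: nbhs_infty_ge.
  exact: (near_infty_natSinv_lt (PosNum e2)).
rewrite (le_trans (ler_normB _ _))//.
rewrite (le_trans (lerD (pairing_bound _ _ hpair) (pairing_bound _ _ hpair)))//.
rewrite -mulrDl (le_trans (ler_wpM2l _ (ltW dj))) ?addr_ge0//.
apply: (@le_trans _ _ (K * (e / 2 / K))); last by rewrite mulrC divfK ?gt_eqF.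
apply: ler_wpM2r; first exact: ltW.
by rewrite /K -addrA lerD2l ler_wpDr// uM.
Unshelve. all: by end_near. Qed.
End BanachAlaoglu.

(** * Inner products on a real Hilbert space *)

Section InnerProduct.
Context {R : realType} {H : completeNormedModType R} {ip : {dot H for idfun}}.
Context (hH : is_hilbert ip).

Lemma inner_sym u v : ip u v = ip v u.
Proof. by rewrite (hermC ip) expr0 mul1r. Qed.

Lemma innerDl u v w : ip (u + v) w = ip u w + ip v w.
Proof. by rewrite linearDl. Qed.

Lemma innerZl a u w : ip (a *: u) w = a * ip u w.
Proof. by rewrite linearZl. Qed.

Lemma innerNl u w : ip (- u) w = - ip u w.
Proof. by rewrite linearNl. Qed.

Lemma innerDr u v w : ip w (u + v) = ip w u + ip w v.
Proof. by rewrite linearDr. Qed.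

Lemma innerZr a u w : ip w (a *: u) = a * ip w u.
Proof. by rewrite linearZr. Qed.

Lemma innerNr u w : ip w (- u) = - ip w u.
Proof. by rewrite linearNr. Qed.

Lemma normB_sqr u v : `|u - v| ^+ 2 = `|u| ^+ 2 - 2 * ip u v + `|v| ^+ 2.
Proof.
rewrite !hH !(innerDl, innerDr, innerNl, innerNr) (inner_sym v u); ring.
Qed.

(** Cauchy-Schwarz, from expanding the norm of [|v|^2 u - (ip u v) v]. *)
Lemma inner_bound u v : `|ip u v| <= `|u| * `|v|.
Proof.
have [->|v0] := eqVneq v 0.
  by rewrite -(scale0r v) innerZr mul0r normr0 mulr_ge0.
have v2 : 0 < `|v| ^+ 2 by rewrite exprn_gt0// normr_gt0.
rewrite -ler_sqr ?nnegrE// ?mulr_ge0// exprMn real_normK ?num_real//.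
rewrite -(ler_pM2l v2) -subr_ge0.
have := sqr_ge0 `|(`|v| ^+ 2) *: u - ip u v *: v|.
rewrite normB_sqr innerZl innerZr !normrZ !exprMn !real_normK ?num_real//.
by congr (0 <= _); ring.
Qed.
End InnerProduct.

Lemma inner_continuous {R : realType} {X H : completeNormedModType R}
    (ip : {dot H for idfun}) (A : {linear X -> H}) (q : H) :
  is_hilbert ip -> continuous A -> continuous (H_to_dual ip A q).
Proof.
move=> hH cA x.
have cq : continuous (H_to_dual ip (idfun : {linear H -> H}) q).
  by apply: (@linear_bound_continuous _ _ _ _ `|q|) => y; exact: inner_bound.
exact: (continuous_comp (cA x) (cq (A x))).
Qed.

(** * The direct method *)

Lemma lte_real_between {R : realType} (c : R) (x : \bar R) :
  (c%:E < x)%E -> exists2 a : R, c < a & (a%:E < x)%E.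
Proof.
case: x => [r| |] //.
  by rewrite lte_fin => cr; exists ((c + r) / 2); rewrite ?lte_fin; lra.
by move=> _; exists (c + 1); rewrite ?ltry//; lra.
Qed.

Section DirectMethod.
Context {R : realType} {X Y H : completeNormedModType R}.
Context {pair : {bilinear X -> Y -> R^o}} {ip : {dot H for idfun}}.
Context {A : {linear X -> H}}.
Context (hY : separable Y).
Context (hdual : dual_pairing pair).
Context (hH : is_hilbert ip).
Context (hweak : forall (u : nat -> X) (x : X),
  (u : nat -> weak_star pair) @ \oo --> (x : weak_star pair) ->
  weak_cvg (fun n => A (u n)) (A x)).

(** Sublevel sets are bounded, so a minimizing sequence has a weak* convergent
    subsequence, whose image under [A] converges weakly in [H].  Along it,
    [|x - h|^2 >= |y - h|^2 + 2 ip (y - h) (x - y)] makes the squared distance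
    lower semicontinuous.  [Phi] is approached from below by reals
    [a < Phi v], which covers the value [+oo]. *)
Lemma direct_method (h : H) (Phi : X -> \bar R) (v0 : X) (M : R) :
  let G v := ((2^-1 * `|A v - h| ^+ 2)%:E + Phi v)%E in
  (forall v, 0 <= Phi v)%E ->
  lower_semicontinuous (Phi : weak_star pair -> \bar R) ->
  (Phi v0 < +oo)%E ->
  (forall v, (G v <= G v0)%E -> `|v| <= M) ->
  exists v, is_minimizer G v.
Proof.
move=> G Phi0 lscPhi Phiv0 GM.
have G0 v : (0 <= G v)%E by rewrite adde_ge0// lee_fin mulr_ge0.
pose I := ereal_inf (range G).
have IG v : (I <= G v)%E by apply: ereal_inf_lbound; exists v.
have Ifin : I \is a fin_num.
  rewrite ge0_fin_numE; last by apply: le_ereal_inf_tmp => _ [v _ <-].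
  by rewrite (le_lt_trans (IG v0))// lte_add_pinfty// ltry.
have /choice[u uP] (n : nat) : exists v : X,
    (G v <= I + (n.+1%:R^-1)%:E)%E /\ (G v <= G v0)%E.
  have [|_ [v _ <-] vI] := @lb_ereal_inf_adherent _ (range G) n.+1%:R^-1 _ Ifin.
    by rewrite invr_gt0.
  have [vv0|v0v] := leP (G v) (G v0); first by exists v; rewrite (ltW vI).
  by exists v0; rewrite ltW// (lt_trans v0v).
have [s [v [ks usv]]] := @bounded_weak_star_subsequence _ _ _ _ hdual u M hY
  (fun n => GM _ (uP n).2).
have ipv := @hweak _ _ usv (H_to_dual ip (idfun : {linear H -> H}) (A v - h))
  (@inner_continuous _ _ _ _ (idfun : {linear H -> H}) _ hH (fun x => cvg_id)).
exists v => w; apply: le_trans (IG w).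
rewrite -(fineK Ifin); set i := fine I.
have key (a : R) : (a%:E < Phi v)%E -> 2^-1 * `|A v - h| ^+ 2 + a <= i.
  move=> /lscPhi[V nV VPhi]; apply/ler_addgt0Pr => e e0.
  have e2 : 0 < e / 2 by rewrite divr_gt0.
  near \oo => k.
  have aPhi : (a%:E < Phi (u (s k)))%E.
    by apply: VPhi; near: k; exact: usv.
  have Gk : 2^-1 * `|A (u (s k)) - h| ^+ 2 + a <= i + e / 2.
    rewrite -lee_fin EFinD; apply: (@le_trans _ _ (G (u (s k)))).
      by rewrite leeD2l// ltW.
    apply: (le_trans (uP _).1); rewrite EFinD (fineK Ifin) leeD2l// lee_fin.
    apply: (@le_trans _ _ (k.+1%:R^-1)).
      by rewrite lef_pV2 ?posrE// ler_nat ltnS.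
    by apply: ltW; near: k; exact: (near_infty_natSinv_lt (PosNum e2)).
  have ipk : ip (A v - h) (A v) - ip (A v - h) (A (u (s k))) < e / 2.
    apply: (le_lt_trans (ler_norm _)).
    by near: k; move/cvgrPdist_lt : ipv; apply.
  have := sqr_ge0 `|(A (u (s k)) - h) - (A v - h)|.
  rewrite (normB_sqr hH) (inner_sym _ (A v - h)) innerDr innerNr.
  have : `|A v - h| ^+ 2 = ip (A v - h) (A v) - ip (A v - h) h.
    by rewrite hH innerDr innerNr.
  by lra.
have [Pv|/lte_real_between[a ca /key]] :=
    leP (Phi v) (i - 2^-1 * `|A v - h| ^+ 2)%:E;
  last by rewrite -lerBrDl leNgt ca.
by apply: (le_trans (leeD2l _ Pv)); rewrite -EFinD lee_fin; lra.
Unshelve. all: by end_near. Qed.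
End DirectMethod.

(** * Subgradients of one-homogeneous functionals *)

Lemma le_of_le_small {R : realType} (a b c : R) :
  (forall t, 0 < t <= 1 -> a <= b + t * c) -> a <= b.
Proof.
move=> h; apply/ler_addgt0Pr => e e0.
have k0 : 0 < `|c| + e + 1 by rewrite addr_gt0// ltr_wpDl.
pose t := e / (`|c| + e + 1).
have t0 : 0 < t by rewrite divr_gt0.
have t1 : t <= 1 by rewrite ler_pdivrMr// mul1r -addrA addrCA lerDl addr_ge0.
apply: (le_trans (h t _)); first by rewrite t0.
rewrite lerD2l (le_trans (ler_norm _))// normrM gtr0_norm// mulrAC.
rewrite ler_pdivrMr//.
by rewrite ler_pM2l// -addrA lerDl addr_ge0// ltW.
Qed.

Section Tikhonov.
Context {R : realType} {X Y H : completeNormedModType R}.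
Context {pair : {bilinear X -> Y -> R^o}} {ip : {dot H for idfun}}.
Context {A : {linear X -> H}} {J : X -> \bar R}.
Context (hJ0 : nonneg_fun J).
Context (hJhom : abs_one_homogeneous J).

Lemma homogeneous0 : J 0 = 0%E.
Proof. by rewrite -(scale0r 0) hJhom normr0 mul0e. Qed.

Lemma nonneg_fin_num u : (J u < +oo)%E -> J u \is a fin_num.
Proof. by move=> Ju; rewrite ge0_fin_numE. Qed.

(** Testing the subgradient inequality at [0] and at [2 u] gives [J u = q u]. *)
Lemma subdiff_homogeneous (u : X) (q : {linear X -> R^o}) :
  (J u < +oo)%E -> subdiff J u q ->
  (forall w, (q w : R)%:E <= J w)%E /\ J u = (q u : R)%:E.
Proof.
move=> /nonneg_fin_num/fineK Ju [_ qu].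
have hi : fine (J u) <= q u.
  have := qu 0; rewrite homogeneous0 sub0r linearN/= -Ju -EFinD lee_fin.
  by rewrite subr_le0.
have lo : q u <= fine (J u).
  have := qu (2 *: u); rewrite hJhom -Ju -EFinM -EFinD lee_fin ger0_norm//.
  rewrite linearB linearZ/= /GRing.scale/=; lra.
have Jq : J u = (q u : R)%:E by rewrite -Ju; congr EFin; apply/le_anti/andP.
split=> // w; apply: le_trans (qu w).
by rewrite Jq -EFinD lee_fin linearB/= addrC subrK.
Qed.

Context (hH : is_hilbert ip).
Context (hA : continuous A).

Lemma subdiff0P (q : H) : subdiff J 0 (H_to_dual ip A q) <->
  forall w, ((ip q (A w))%:E <= J w)%E.
Proof.
split=> [[_ q0] w|qJ].
  by have := q0 w; rewrite homogeneous0 add0e subr0.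
split; first exact: inner_continuous.
by move=> w; rewrite homogeneous0 add0e subr0; exact: qJ.
Qed.

(** Clearing denominators turns the bound on the infimum into a family of linear
    inequalities.  Points with [`|q| = `|p|] have quotient [+oo]; there the
    inequality only asks for [ip q (A f) <= J f], which holds for every [q] in
    the subdifferential at 0. *)
Lemma le_tau_hatP (f : X) (p : H) (tau : R) :
  (J f < +oo)%E ->
  (tau%:E <= tau_hat ip A J f p)%E <->
  forall q : H, subdiff J 0 (H_to_dual ip A q) -> `|q| <= `|p| ->
    tau / 2 * (`|p| ^+ 2 - `|q| ^+ 2) <= fine (J f) - ip q (A f).
Proof.
move=> Jf; rewrite /tau_hat -lee_pdivrMl//.
have Jr := esym (fineK (nonneg_fin_num Jf)); set r := fine (J f) in Jr *.
rewrite Jr.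
split=> [tauI q Kq qp|tauq].
  have qr : 0 <= r - ip q (A f).
    by rewrite subr_ge0 -lee_fin -Jr; exact: (subdiff0P q).1.
  have [->|d0] := eqVneq (`|p| ^+ 2 - `|q| ^+ 2) 0; first by rewrite mulr0.
  have d_gt0 : 0 < `|p| ^+ 2 - `|q| ^+ 2.
    by rewrite lt_def d0 subr_ge0 ler_sqr ?nnegrE.
  rewrite -ler_pdivlMr// -lee_fin mulrC.
  apply: (le_trans tauI); apply: ereal_inf_lbound; exists q => //.
  by rewrite /quotient_or_pinfty (negbTE d0).
apply: le_ereal_inf_tmp => _ [q [Kq qp] <-].
rewrite /quotient_or_pinfty; case: eqVneq => [_|d0]; first exact: leey.
have d_gt0 : 0 < `|p| ^+ 2 - `|q| ^+ 2.
  by rewrite lt_def d0 subr_ge0 ler_sqr ?nnegrE.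
by rewrite -EFinD -EFinM lee_fin ler_pdivlMr// (mulrC _^-1); exact: tauq.
Qed.

Context (hJconvex : convex_fun J).

(** First-order condition.  Comparing [v] with [t w + (1 - t) v] and dividing by
    [t], convexity of [J] leaves the subgradient inequality up to an error
    [t |A (w - v)|^2 / 2], which vanishes as [t] tends to 0. *)
Lemma minimizer_subgradient (f v : X) (tau : R) :
  0 < tau -> (J f < +oo)%E -> is_minimizer (F_functional A J tau f) v ->
  (J v < +oo)%E /\ subdiff J v (H_to_dual ip A (tau^-1 *: (A f - A v))).
Proof.
move=> tau0 Jf vmin.
have Jv : (J v < +oo)%E.
  have := vmin f; rewrite /F_functional subrr normr0 expr0n mulr0 add0e.
  rewrite -(fineK (nonneg_fin_num Jf)) -EFinM.
  have := hJ0 v; case: (J v) => [r _ _| |//]; first exact: ltry.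
  by rewrite gt0_muley ?lte_fin// addey.
split => //; split; first exact: inner_continuous.
move=> w; have := hJ0 w; case Jw : (J w) => [b| |//] _; last exact: leey.
rewrite -(fineK (nonneg_fin_num Jv)) -EFinD lee_fin; set a := fine (J v).
rewrite [X in a + X](_ : _ = tau^-1 * ip (A f - A v) (A w - A v)); last first.
  by rewrite -innerZl -(linearB A w v).
suff : tau * a <= tau * b - ip (A f - A v) (A w - A v).
  rewrite -(ler_pM2l tau0) mulrDr mulrA mulfV ?gt_eqF// mul1r; lra.
apply: (@le_of_le_small _ _ _ (2^-1 * `|A w - A v| ^+ 2)) => t /andP[t0 t1].
rewrite -(ler_pM2l t0).
have := vmin (t *: w + (1 - t) *: v)%R.
have : (J (t *: w + (1 - t) *: v)%R <= (t * b + (1 - t) * a)%:E)%E.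
  rewrite EFinD !EFinM /a (fineK (nonneg_fin_num Jv)) -Jw.
  by apply: hJconvex; rewrite ltW.
have := hJ0 (t *: w + (1 - t) *: v)%R; rewrite /F_functional.
case: (J (t *: w + (1 - t) *: v)%R) => [c _| |//]; last by rewrite leye_eq.
rewrite lee_fin -(fineK (nonneg_fin_num Jv)) -/a -!EFinM -!EFinD lee_fin.
rewrite linearD !linearZ/=.
rewrite (_ : t *: A w + (1 - t) *: A v - A f =
    t *: (A w - A v) - (A f - A v)); last first.
  by rewrite scalerBl scale1r scalerBr opprB !addrA (addrAC (t *: A w)).
rewrite (distrC (A v)).
rewrite (normB_sqr hH (t *: _)) innerZl (inner_sym (A w - A v)) normrZ.
rewrite gtr0_norm// exprMn.
move=> cc Fm.
have : tau * c <= tau * (t * b + (1 - t) * a) by rewrite ler_pM2l.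
by nra.
Qed.

(** * Existence of minimizers *)

Context (hY : separable Y).
Context (hdual : dual_pairing pair).
Context (hJlsc : lower_semicontinuous (J : weak_star pair -> \bar R)).
Context (hequiv : norms_equivalent_on_null_set A J).
Context (hpoincare : poincare_inequality A J).
Context (hweak : forall (u : nat -> X) (x : X),
  (u : nat -> weak_star pair) @ \oo --> (x : weak_star pair) ->
  weak_cvg (fun n => A (u n)) (A x)).

(** Minimization of the distance plus the indicator function of the null set,
    which inherits weak* lower semicontinuity from [J]; boundedness in [X] comes
    from the equivalence of norms on the null set. *)
Lemma null_projection_exists (u : X) : exists w, is_null_projection A J u w.
Proof.
have [c [C1 [c0 _ cA]]] := hequiv.
pose Phi v : \bar R := if J v == 0%E then 0%E else +oo%E.
have Phi0 v : (0 <= Phi v)%E by rewrite /Phi; case: ifP.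
have PhiN v : (Phi v < +oo)%E -> J v = 0%E.
  by rewrite /Phi; case: ifP => [/eqP//|]; rewrite ltxx.
have NPhi v : J v = 0%E -> Phi v = 0%E by rewrite /Phi => ->; rewrite eqxx.
have Phi_lsc : lower_semicontinuous (Phi : weak_star pair -> \bar R).
  move=> v a; rewrite {1}/Phi; case: ifPn => [_|Jv] aPhi.
    by exists setT; [exact: filterT|move=> y _; exact: lt_le_trans (Phi0 y)].
  have [|V nV VJ] := @hJlsc v 0; first by rewrite lt_def Jv/=; exact: hJ0.
  by exists V => // y /VJ Jy; rewrite /Phi gt_eqF// ltry.
have Phi00 : Phi 0 = 0%E by apply: NPhi; exact: homogeneous0.
have [|v|w wmin] := @direct_method _ _ _ _ _ _ A hY hdual hH hweak (A u) Phi 0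
    (2 * `|A u| / c) Phi0 Phi_lsc.
- by rewrite Phi00 ltry.
- rewrite linear0 sub0r normrN Phi00 adde0 => Gv.
  have Nv : J v = 0%E.
    apply: PhiN; apply: le_lt_trans (ltry (2^-1 * `|A u| ^+ 2)).
    by apply: le_trans Gv; rewrite leeDr// lee_fin mulr_ge0.
  move: Gv; rewrite (NPhi _ Nv) adde0 lee_fin ler_pM2l// ler_sqr ?nnegrE//.
  move=> Av.
  rewrite ler_pdivlMr// mulrC (le_trans (proj1 (andP (cA _ Nv))))//.
  rewrite -(subrK (A u) (A v)) (le_trans (ler_normD _ _))//; lra.
have Nw : J w = 0%E.
  apply: PhiN; apply: le_lt_trans (ltry (2^-1 * `|A 0 - A u| ^+ 2)).
  have := wmin 0; rewrite Phi00 adde0; apply: le_trans.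
  by rewrite leeDr// lee_fin mulr_ge0.
exists w; split=> // w' Nw'; have := wmin w'.
by rewrite (NPhi _ Nw) (NPhi _ Nw') !adde0 lee_fin ler_pM2l// ler_sqr ?nnegrE.
Qed.

(** Coercivity: on a sublevel set both [J v] and [`|A v - A f|] are bounded.
    With [w] the projection of [v] onto the null set, the Poincare inequality
    bounds [`|v - w|], while [`|A w| <= 2 `|A v|], obtained by comparing [w] with the
    competitor 0, bounds [`|w|]. *)
Lemma F_functional_minimizer_exists (f : X) (tau : R) :
  0 < tau -> (J f < +oo)%E ->
  exists v, is_minimizer (F_functional A J tau f) v.
Proof.
move=> tau0 Jf.
have [c [C1 [c0 _ cA]]] := hequiv.
have [C C0 CP] := hpoincare.
have Jr := esym (fineK (nonneg_fin_num Jf)); set r := fine (J f) in Jr *.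
pose Phi v := (tau%:E * J v)%E.
have Phi0 v : (0 <= Phi v)%E.
  by apply: mule_ge0; [rewrite lee_fin ltW|exact: hJ0].
have Phi_lsc : lower_semicontinuous (Phi : weak_star pair -> \bar R).
  move=> v a; rewrite /Phi -lte_pdivrMl// -EFinM => /hJlsc[V nV VJ].
  by exists V => // y /VJ; rewrite EFinM lte_pdivrMl.
(* [x <= 1 + x^2] avoids a square root. *)
pose B := 1 + 2 * tau * r.
pose M := C * r + 2 * (B + `|A f|) / c.
suff bounded v : (F_functional A J tau f v <= F_functional A J tau f f)%E ->
    `|v| <= M.
  have Phif : (Phi f < +oo)%E by rewrite /Phi Jr -EFinM ltry.
  exact: (direct_method hY hdual hH hweak Phi0 Phi_lsc Phif bounded).
rewrite /F_functional subrr normr0 expr0n mulr0 add0e => Gv.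
have Jv : (J v <= r%:E)%E.
  rewrite -Jr -(@lee_pmul2l _ tau%:E)//.
  by apply: le_trans Gv; rewrite leeDr// lee_fin mulr_ge0.
have AvB : `|A v - A f| <= B.
  have : 2^-1 * `|A v - A f| ^+ 2 <= tau * r.
    rewrite -lee_fin (EFinM tau) -Jr; apply: le_trans Gv.
    by rewrite leeDl ?Phi0.
  have := sqr_ge0 (`|A v - A f| - 1); have := sqr_ge0 `|A v - A f|.
  by rewrite /B; lra.
have [w wP] := null_projection_exists v.
have vw : `|v - w| <= C * r.
  by rewrite -lee_fin (le_trans (CP _ _ wP))// EFinM lee_pmul2l.
have wv : c * `|w| <= 2 * (B + `|A f|).
  apply: (le_trans (proj1 (andP (cA _ wP.1)))).
  have := wP.2 0 homogeneous0; rewrite linear0 sub0r normrN => wv.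
  have Av : `|A v| <= B + `|A f|.
    by rewrite -(subrK (A f) (A v)) (le_trans (ler_normD _ _))// lerD2r.
  rewrite -(subrK (A v) (A w)) (le_trans (ler_normD _ _))//; lra.
rewrite -(subrK w v) (le_trans (ler_normD _ _))// lerD//.
by rewrite ler_pdivlMr// mulrC.
Qed.

(** * The minimizers below the critical parameter *)

(** The subgradient [q] at the minimizer is in the admissible set of [tau_hat];
    the bound it satisfies there and the inequality [ip p (A v) <= J v] leave
    room only for [q = p]. *)
Lemma minimizer_residual (f v : X) (p : H) (tau : R) :
  0 < tau -> (J f < +oo)%E -> subdiff J f (H_to_dual ip A p) ->
  (tau%:E <= tau_hat ip A J f p)%E ->
  is_minimizer (F_functional A J tau f) v -> A v = A f - tau *: p.
Proof.
move=> tau0 Jf pf /(le_tau_hatP _ _ Jf) tauK vmin.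
have [Jv qv] := minimizer_subgradient tau0 Jf vmin.
set q := tau^-1 *: (A f - A v) in qv.
have tauq : A v = A f - tau *: q.
  by rewrite /q scalerA mulfV ?gt_eqF// scale1r opprB addrC subrK.
(* [q] mentions [A v]: keep it opaque while [A v] is rewritten below. *)
clearbody q.
have [qK Jvq] := subdiff_homogeneous Jv qv.
have [pK Jfp] := subdiff_homogeneous Jf pf.
have fine_f : fine (J f) = ip p (A f) by rewrite Jfp.
have pv : ip p (A v) <= ip q (A v) by have := pK v; rewrite Jvq lee_fin.
have qf : ip q (A f) <= ip p (A f) by have := qK f; rewrite Jfp lee_fin.
move: pv; rewrite tauq !(innerDr, innerNr, innerZr) (inner_sym p q) => pv.
rewrite -hH in pv.
have pq2 := normB_sqr hH p q; rewrite (inner_sym p q) in pq2.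
have qqpq : `|q| ^+ 2 <= ip q p.
  by rewrite -(ler_pM2l tau0); lra.
have qp : `|q| <= `|p|.
  rewrite -ler_sqr ?nnegrE//; have := sqr_ge0 `|p - q|; lra.
have := tauK q ((subdiff0P q).2 qK) qp; rewrite fine_f => tq.
have : `|p - q| ^+ 2 <= 0.
  by rewrite -(ler_pM2l tau0) mulr0 pq2; lra.
by rewrite real_exprn_even_le0//= normr_eq0 subr_eq0 => /eqP ->.
Qed.

(** The first-order condition at [f - tau p] returns [p] as a subgradient there,
    so [q] in the subdifferential at 0 pairs with [f - tau p] to at most
    [J f - tau |p|^2]; [2 ip q p <= |p|^2 + |q|^2] does the rest. *)
Lemma affine_minimizer_le_tau_hat (f : X) (p : H) (tau : R) :
  0 < tau -> (J f < +oo)%E -> subdiff J f (H_to_dual ip A p) ->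
  affine_minimizer A J f p tau -> (tau%:E <= tau_hat ip A J f p)%E.
Proof.
move=> tau0 Jf pf [v [Av [vmin _]]].
apply/(le_tau_hatP _ _ Jf) => q /subdiff0P qK _.
have [Jv] := minimizer_subgradient tau0 Jf vmin.
rewrite Av opprB addrC subrK scalerA mulVf ?gt_eqF// scale1r => pv.
have [_ Jvp] := subdiff_homogeneous Jv pv.
have [_ Jfp] := subdiff_homogeneous Jf pf.
have fine_f : fine (J f) = ip p (A f) by rewrite Jfp.
have qv : ip q (A v) <= ip p (A v) by have := qK v; rewrite Jvp lee_fin.
move: qv; rewrite Av fine_f !(innerDr, innerNr, innerZr) => qv.
have := mulr_ge0 (ltW tau0) (sqr_ge0 `|p - q|).
rewrite -hH in qv; rewrite (normB_sqr hH) (inner_sym p q); lra.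
Qed.

(** A minimizer exists and every minimizer has image [A f - tau p], so
    injectivity of [A] yields uniqueness as well.  For [tau = 0] the functional
    is half the squared distance to [f], also where [J] is infinite because
    [0 * +oo = 0]. *)
Lemma affine_minimizer_of_le_tau_hat (f : X) (p : H) (tau : R) :
  injective A ->
  0 <= tau -> (J f < +oo)%E -> subdiff J f (H_to_dual ip A p) ->
  (tau%:E <= tau_hat ip A J f p)%E -> affine_minimizer A J f p tau.
Proof.
move=> Ainj; rewrite le_eqVlt => /predU1P[<- _ _ _|tau0 Jf pf tauh].
  have F0 w : F_functional A J 0 f w = (2^-1 * `|A w - A f| ^+ 2)%:E.
    by rewrite /F_functional mul0e adde0.
  exists f; split; first by rewrite scale0r subr0.
  split=> [w|w /(_ f)]; rewrite !F0 subrr normr0 expr0n mulr0 lee_fin.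
    by rewrite mulr_ge0.
  rewrite pmulr_rle0// real_exprn_even_le0//= normr_eq0 subr_eq0 => /eqP.
  exact: Ainj.
have [v vmin] := F_functional_minimizer_exists tau0 Jf.
have Av := minimizer_residual tau0 Jf pf tauh vmin.
exists v; split=> //; split=> // w /(minimizer_residual tau0 Jf pf tauh) Aw.
by apply: Ainj; rewrite Aw.
Qed.
End Tikhonov.

Theorem theorem4p14 (R : realType)
  (* the predual Y, the space X = Y^*, and the Hilbert space H *)
  (Y X H : completeNormedModType R)
  (pair : {bilinear X -> Y -> R^o})
  (ip : {dot H for idfun})
  (A : {linear X -> H})
  (J : X -> \bar R)
  (f : X) (p : H)
  (hY : separable Y)
  (hdual : dual_pairing pair)
  (hH : is_hilbert ip)
  (hA : gelfand_triple A)
  (hJ0 : nonneg_fun J)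
  (hJproper : proper_fun J)
  (hJconvex : convex_fun J)
  (hJlsc : lower_semicontinuous (J : weak_star pair -> \bar R))
  (hJhom : abs_one_homogeneous J)
  (hequiv : norms_equivalent_on_null_set A J)
  (hpoincare : poincare_inequality A J)
  (hweak : forall (u : nat -> X) (x : X),
     (u : nat -> weak_star pair) @ \oo --> (x : weak_star pair) ->
     weak_cvg (fun n => A (u n)) (A x))
  (hf : (0 < J f < +oo)%E)
  (hp : subdiff J f (H_to_dual ip A p))
  (hps : (`|p|)%:E = s_star ip A J f) :
  ((0 < tau_hat ip A J f p)%E <->
     exists2 T : R, 0 < T &
       forall tau : R, 0 <= tau <= T -> affine_minimizer A J f p tau)
  /\
  ((0 < tau_hat ip A J f p)%E ->
     forall tau : R, 0 <= tau -> (tau%:E <= tau_hat ip A J f p)%E ->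
       affine_minimizer A J f p tau).
Proof.
have [cA Ainj _] := hA; have /andP[_ Jf] := hf.
have below tau : 0 <= tau -> (tau%:E <= tau_hat ip A J f p)%E ->
    affine_minimizer A J f p tau.
  move=> tau0 tauh.
  exact: (affine_minimizer_of_le_tau_hat hJ0 hJhom hH cA hJconvex hY hdual hJlsc
    hequiv hpoincare hweak Ainj tau0 Jf hp tauh).
split; last by move=> _.
split=> [th0|[T T0 hT]].
  have [T T0 Tth] : exists2 T : R, 0 < T & (T%:E <= tau_hat ip A J f p)%E.
    case: (tau_hat ip A J f p) th0 => [t t0| _|//]; first by exists t.
    by exists 1; rewrite ?leey.
  exists T => // tau /andP[tau0 tauT]; apply: below => //.
  by rewrite (le_trans _ Tth)// lee_fin.
rewrite (@lt_le_trans _ _ T%:E) ?lte_fin//.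
apply: (affine_minimizer_le_tau_hat hJ0 hJhom hH cA hJconvex T0 Jf hp).
by apply: hT; rewrite lexx ltW.
Qed.
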